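(* Let $X$ be a Banach space which does not have the approximation property, and let $Z$ be the Banach space constructed from $X$ (and a sequence $\{x_n\}_{n=1}^\infty\subseteq X$) as described in the context. Then $Z$ has the compact approximation property.
   Context: All Banach spaces are over the real scalars. A Banach space $E$ has the approximation property if for every compact set $K\subseteq E$ and every $\varepsilon>0$ there is a bounded finite rank operator $T$ on $E$ with $\|Tx-x\|<\varepsilon$ for every $x\in K$. $E$ has the compact approximation property if for every compact set $K\subseteq E$ and every $\varepsilon>0$ there is a compact operator $T$ on $E$ with $\|Tx-x\|<\varepsilon$ for every $x\in K$. Construction of $Z$. Let $X$ be a Banach space without the approximation property. Let $\{x_n\}_{n=1}^\infty$ be a sequence of nonzero vectors in $X$ such that $\|x_n\|\le 1$ for all $n$, $\|x_n\|$ decreases (in the weak sense) to $0$, and the identity operator of $X$ cannot be approximated by finite rank operators on the compact set $K=\overline{\mathrm{conv}}\{x_n\}_{n=1}^\infty$; that is, there is $\varepsilon>0$ such that no bounded finite rank operator $T$ on $X$ satisfies $\|Tx-x\|<\varepsilon$ for all $x\in K$. (Such a sequence exists because $X$ lacks the approximation property, by a theorem of Grothendieck that every norm compact subset of a Banach space is contained in the closed convex hull of a sequence converging to $0$.) For $0<t<1$ put $U_t=\overline{\mathrm{conv}}\{\pm x_n/\|x_n\|^t\}_{n=1}^\infty$, a compact, convex, symmetric subset of $X$. Let $Y_t$ be the linear span of $U_t$ with the norm $|||x|||_t=\inf\{|\lambda| : \lambda^{-1}x\in U_t\}$ for $x\in Y_t$. Then $(Y_t,|||\cdot|||_t)$ is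 a Banach space with closed unit ball $U_t$, and for $s<t$ one has $U_s\subseteq U_t$ and $Y_s\subseteq Y_t\subseteq X$. For $0<s<t<1$ and $y\in Y_s$ let $y\chi_{(s,t)}:(0,1)\to X$ be the function equal to $y$ on $(s,t)$ and $0$ elsewhere. Let $\mathcal Z$ be the linear span of $\{y\chi_{(s,t)} : 0<s<t<1,\ y\in Y_s\}$, functions which are equal almost everywhere being identified. Each $f\in\mathcal Z$ satisfies $f(r)\in Y_r$ for (almost) all $r$, and $\mathcal Z$ is normed by $\|f\|=\int_0^1|||f(r)|||_r\,dr$. The Banach space $Z$ is the completion of $\mathcal Z$ with respect to this norm. *)

(* Defs.v *)
From HB Require Import structures.
From mathcomp Require Import all_boot all_order all_algebra.
From mathcomp Require Import all_classical all_reals all_analysis.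

Set Implicit Arguments.
Unset Strict Implicit.
Unset Printing Implicit Defensive.

Import Order.TTheory GRing.Theory Num.Theory.
Import numFieldNormedType.Exports.

Local Open Scope classical_set_scope.
Local Open Scope ring_scope.

(* MathComp-Analysis development; scalars form an arbitrary R : realType, and a
   Banach space is a completeNormedModType R. *)

Definition lspan (R : realType) (V : lmodType R) (A : set V) : set V :=
  smallest (fun S : set V => GRing.submod_closed (mem S)) A.

Definition conv_hull (R : realType) (V : lmodType R) (A : set V) : set V :=
  smallest (@convex_set R V) A.

Definition closed_conv_hull (R : realType) (E : normedModType R) (A : set E) :
    set E :=
  closure (conv_hull A).

Section ApproximationProperties.
Context {R : realType}.

Definition finite_rank (E F : lmodType R) (T : E -> F) : Prop :=
  exists s : seq F, range T `<=` lspan [set` s].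

Definition compact_operator (E F : normedModType R) (T : {linear E -> F}) :
    Prop :=
  precompact (T @` closed_ball (0 : E) 1).

(* For a linear map, continuity is boundedness (linear_bounded_continuous). *)
Definition finite_rank_approximable_on (E : normedModType R) (K : set E)
    (e : R) : Prop :=
  exists T : {linear E -> E},
    [/\ continuous T, finite_rank T & forall z, K z -> `|T z - z| < e].

Definition approximation_property (E : normedModType R) : Prop :=
  forall K : set E, compact K ->
  forall e : R, 0 < e -> finite_rank_approximable_on K e.

Definition compact_approximation_property (E : normedModType R) : Prop :=
  forall K : set E, compact K ->
  forall e : R, 0 < e ->
  exists T : {linear E -> E},
    compact_operator T /\ forall z, K z -> `|T z - z| < e.

End ApproximationProperties.

Section Construction.
Context {R : realType} {X : completeNormedModType R}.
Variable x : nat -> X.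

Definition Uset (t : R) : set X :=
  closed_conv_hull
    (range (fun n => (`|x n| `^ t)^-1 *: x n) `|`
     range (fun n => - ((`|x n| `^ t)^-1 *: x n))).

Definition Yspace (t : R) : set X := lspan (Uset t).

(* l = 0 must be excluded by hand: 0^-1 = 0 and 0 lies in Uset t, so keeping it
   would make the infimum vanish identically. *)
Definition Ynorm (t : R) (z : X) : R :=
  inf [set `|l| | l in [set l : R | l != 0 /\ Uset t (l^-1 *: z)]].

(* Functions on (0, 1) are represented by functions on R vanishing outside. *)
Definition step (s t : R) (y : X) : R -> X :=
  fun r => if s < r < t then y else 0.

Definition Zpre : set (R -> X) :=
  lspan [set f | exists s t : R, exists y : X,
    [/\ 0 < s, s < t, t < 1, Yspace s y & f = step s t y]].

Definition Zpre_norm (f : R -> X) : \bar R :=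
  (\int[lebesgue_measure]_(r in `]0%R, 1%R[) (Ynorm r (f r))%:E)%E.

Definition Zpre_eq (f g : R -> X) : Prop :=
  {ae lebesgue_measure, forall r : R, 0 < r < 1 -> f r = g r}.

(* J exhibits the Banach space Z as the completion of the quotient of Zpre by
   almost everywhere equality, J f being the image of the class of f; only the
   values of J on Zpre matter. Such a pair (Z, J) exists and is unique up to
   isometric isomorphism. *)
Record is_Z_completion (Z : completeNormedModType R) (J : (R -> X) -> Z) :
    Prop := {
  completion_linear : forall (a : R) (f g : R -> X), Zpre f -> Zpre g ->
    J (a *: f + g) = a *: J f + J g ;
  completion_ae : forall f g : R -> X, Zpre f -> Zpre g ->
    (J f = J g <-> Zpre_eq f g) ;
  completion_isometry : forall f : R -> X, Zpre f ->
    (`|J f|)%:E = Zpre_norm f ;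
  completion_dense : dense (J @` Zpre)
}.

End Construction.

(* Main.v *)
From HB Require Import structures.
Require Import Defs.
From mathcomp Require Import all_boot all_order all_algebra.
From mathcomp Require Import all_classical all_reals all_analysis.
From mathcomp Require Import measurable_realfun lra ring.
Import Order.TTheory GRing.Theory Num.Theory.
Import numFieldNormedType.Exports.
Local Open Scope classical_set_scope.
Local Open Scope ring_scope.

Set Implicit Arguments.
Unset Strict Implicit.
Unset Printing Implicit Defensive.

(** Let T be the operator that delays a function by d > 0 and replaces it, on
    each cell (p, q) of a partition of (0, 1 - 2 d) finer than d, by its average:
    T f takes on (p + d, q + d) the constant value 1/(q - p) int_p^q f. The
    family of all these operators does what is needed.

    - T is a contraction. The balls U_t increase with t, so the gauge of a
      fixed vector decreases with t. Hence the average of f over (p, q) lies in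
      Y_q with gauge at most 1/(q - p) int_p^q |||f(r)|||_r dr
      ([cell_integral_Ynorm]), and using it on a later interval of length q - p
      costs at most int_p^q |||f(r)|||_r dr. Summing over the cells gives at
      most |f|.

    - T is compact. For f in the unit ball, the average over a cell (p, q) lies
      in a fixed multiple of U_q, and is used only at times r > q. The set U_q
      is the closed convex hull of the vectors x_n / |x_n|^q and their
      opposites, whose gauges at time r are at most |x_n|^(r - q) and tend to
      0; so, up to a small multiple of U_r, U_q is contained in a finite
      dimensional zonotope ([Uset_zonotope_addition],
      [steps_compactly_approximable]).

    - T is close to the identity on a given compact set. If the partition
      contains the endpoints of finitely many given steps, averaging does
      nothing to them, and T merely delays them by d
      ([delay_operator]), which moves the step of value y on (s, t) by at most
      2 d |||y|||_s ([norm_delay_sub]). So T converges to the identity on step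
      functions ([delay_cvg]), hence uniformly on compact sets because all T
      are contractions.

    The partition is never written down. The estimates and the operators
    themselves are obtained by [interval_induction]: they pass from two
    adjacent intervals to their union, so it suffices to treat a short interval
    free of endpoints. On Z, which is known only as a completion, an operator
    is produced from its values on step functions by
    [contractive_relation_extension]. *)

(** * Compactness in normed spaces *)

Lemma compact_addition (R : realType) (E : normedModType R) (A B : set E) :
  compact A -> compact B -> compact [set a + b | a in A & b in B].
Proof.
move=> cA cB.
have -> : [set a + b | a in A & b in B] = (fun z => z.1 + z.2) @` (A `*` B).
  apply/seteqP; split => [_ [a Aa [b Bb <-]]|_ [[a b] [/= Aa Bb] <-]].
    by exists (a, b).
  by exists a => //; exists b.
apply: continuous_compact; last exact: compact_setX.
by apply: continuous_subspaceT => z; exact: add_continuous.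
Qed.

(** If y is not a sum, then y - a avoids the closed set C for every a in A, and
    by compactness it does so for all y' near y uniformly in a. *)
Lemma closed_compact_addition (R : realType) (E : normedModType R)
    (A C : set E) :
  compact A -> closed C -> closed [set a + c | a in A & c in C].
Proof.
move=> /compact_near_coveringP cA cC y; apply: contraPP => nAC.
have cov (a : E) : A a -> \near a & y, ~ C (y - a).
  move=> Aa.
  have oC : nbhs (y - a) (~` C).
    apply: open_nbhs_nbhs; split; first exact: closed_openC.
    by move=> Cya; apply: nAC; exists a => //; exists (y - a) => //; rewrite subrKC.
  have : (z.2 - z.1) @[z --> (a, y)] --> y - a.
    by apply: cvgB; [exact: cvg_snd|exact: cvg_fst].
  by move=> /(_ _ oC).
move=> clACy; have [z [[a Aa [c Cc <-]]]] :=
  clACy _ (cA _ (nbhs y) (fun z a => ~ C (z - a)) _ cov).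
by move=> /(_ _ Aa); rewrite addrAC subrr add0r.
Qed.

(** In a complete space this is relative compactness. The present form passes
    at once to sums and to closures, and finite nets never have to be chosen. *)
Definition compactly_approximable (R : realType) (E : normedModType R)
    (A : set E) :=
  forall e, 0 < e -> exists2 C : set E, compact C &
    forall a, A a -> exists2 c, C c & `|a - c| < e.

(** An ultrafilter on A lives near a compact set C, and by compactness it must
    then charge a small ball around some point of C: it is Cauchy. *)
Lemma compactly_approximable_precompact (R : realType)
    (E : completeNormedModType R) (A : set E) :
  compactly_approximable A -> precompact A.
Proof.
move=> apA; rewrite precompactE compact_ultra => F FU FA.
have FF : ProperFilter F by exact: ultra_proper.
suff /cauchy_cvgP Fcvg : cauchy F.
  exists (lim F); split => //.
  exact: (@closed_cvg _ _ F _ id _ (@closed_closure _ A) FA).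
apply: cauchy_exP => e e0.
have [C cC AC] := apA (e / 4) ltac:(by rewrite divr_gt0).
apply: contrapT => /forallNP nball.
move: cC => /compact_near_coveringP.
move=> /(_ _ F (fun z c => e / 2 < `|z - c|) _) far.
have /far /(filterI FA) /filter_ex [z [clz zC]] :
    forall c, C c -> \forall c' \near c & z \near F, e / 2 < `|z - c'|.
  move=> c Cc.
  have [/nball//|] := in_ultra_setVsetC (ball c e) FU => Fc.
  exists (ball c (e / 4), ~` ball c e) => //=.
    by split => //; apply: nbhsx_ballx; rewrite divr_gt0.
  move=> [c' z] /=; rewrite -!ball_normE /= => -[cc'] /negP.
  rewrite -leNgt => cz.
  have := ler_distD c' c z; rewrite (distrC c' z); lra.
have [a [Aa]] := clz _ (nbhsx_ballx z (e / 4) ltac:(by rewrite divr_gt0)).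
rewrite -ball_normE /= => za.
have [c Cc ac] := AC _ Aa.
by have := zC _ Cc; have := ler_distD a z c; lra.
Qed.

Lemma compactly_approximableS (R : realType) (E : normedModType R)
    (A B : set E) :
  A `<=` closure B -> compactly_approximable B -> compactly_approximable A.
Proof.
move=> AB apB e e0; have e20 : 0 < e / 2 by rewrite divr_gt0.
have [C cC BC] := apB _ e20.
exists C => // a /AB /(_ _ (nbhsx_ballx _ _ e20)) [b [/BC[c Cc bc]]].
rewrite -ball_normE /= => ab; exists c => //.
by have := ler_distD b a c; lra.
Qed.

Lemma compactly_approximable_addition (R : realType) (E : normedModType R)
    (A B : set E) :
  compactly_approximable A -> compactly_approximable B ->
  compactly_approximable [set a + b | a in A & b in B].
Proof.
move=> apA apB e e0; have e20 : 0 < e / 2 by rewrite divr_gt0.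
have [C cC AC] := apA _ e20; have [D cD BD] := apB _ e20.
exists [set c + d | c in C & d in D]; first exact: compact_addition.
move=> _ [a /AC[c Cc ac] [b /BD[d Dd bd] <-]].
exists (c + d); first by exists c => //; exists d.
by rewrite opprD addrACA; have := ler_normD (a - c) (b - d); lra.
Qed.

Definition zonotope (R : realType) (E : lmodType R) (L : R) (w : nat -> E)
    (n : nat) : set E :=
  [set z | exists2 c : nat -> R, (forall i, `|c i| <= L) &
                                 z = \sum_(i < n) c i *: w i].

Lemma compact_zonotope (R : realType) (E : normedModType R) (L : R)
    (w : nat -> E) (n : nat) : 0 <= L -> compact (zonotope L w n).
Proof.
move=> L0; elim: n => [|n IH].
  rewrite (_ : zonotope _ _ _ = [set 0]); first exact: compact_set1.
  apply/seteqP; split => [z [c _ ->]|z ->]; first by rewrite big_ord0.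
  by exists (fun=> 0); rewrite ?big_ord0// => i; rewrite normr0.
rewrite (_ : zonotope _ _ _ = [set a + b | a in zonotope L w n &
    b in (fun t : R => t *: w n) @` `[- L, L]]); last first.
  apply/seteqP; split => [z [c cL ->]|_ [_ [c cL ->] [_ [t tL <-] <-]]].
    exists (\sum_(i < n) c i *: w i); first by exists c.
    exists (c n *: w n); last by rewrite big_ord_recr.
    by exists (c n) => //=; rewrite in_itv/= -ler_norml.
  exists (fun i => if (i < n)%N then c i else t).
    by move=> i; case: ifP => // _; move: tL; rewrite /= in_itv/= -ler_norml.
  rewrite big_ord_recr/= ltnn; congr (_ + _).
  by apply: eq_bigr => i _; rewrite ltn_ord.
apply: compact_addition => //.
apply: continuous_compact; last exact: segment_compact.
by apply: continuous_subspaceT => t; exact: scalel_continuous.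
Qed.

(** * Extending a contractive linear relation *)

(** The relation need not be single-valued a priori: by linearity two values at
    one point differ by a value at 0, which the bound forces to be 0. This
    spares a proof that a formula given on representatives is well defined. *)
Lemma contractive_relation_extension (R : realType) (E : normedModType R)
    (F : completeNormedModType R) (G : E -> F -> Prop) :
  (forall a z w z' w', G z w -> G z' w' -> G (a *: z + z') (a *: w + w')) ->
  (forall z w, G z w -> `|w| <= `|z|) ->
  dense [set z | exists w, G z w] ->
  exists T : {linear E -> F},
    (forall z, `|T z| <= `|z|) /\ (forall z w, G z w -> T z = w).
Proof.
move=> Glin Gbnd Gdense.
(* H is the closure of the graph G; completeness of F makes it total. *)
pose H z w := forall e, 0 < e ->
  exists a b, [/\ G a b, `|z - a| < e & `|w - b| < e].
have GH z w : G z w -> H z w.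
  by move=> Gzw e e0; exists z, w; rewrite !subrr !normr0.
have Hlin a z w z' w' : H z w -> H z' w' -> H (a *: z + z') (a *: w + w').
  move=> Hzw Hzw' e e0.
  have a0 : 0 < `|a| + 1 by rewrite ltr_wpDl.
  have e20 : 0 < e / 2 / (`|a| + 1) by rewrite !divr_gt0.
  have [b [c [Gbc zb wc]]] := Hzw _ e20.
  have [b' [c' [Gbc' zb' wc']]] := Hzw' (e / 2) ltac:(by rewrite divr_gt0).
  exists (a *: b + b'), (a *: c + c'); split; first exact: Glin.
    rewrite opprD addrACA -scalerBr (le_lt_trans (ler_normD _ _))//.
    rewrite normrZ (splitr e) ltrD//.
    rewrite (@le_lt_trans _ _ ((`|a| + 1) * `|z - b|)) ?ler_wpM2r ?lerDl//.
    by rewrite mulrC -ltr_pdivlMr.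
  rewrite opprD addrACA -scalerBr (le_lt_trans (ler_normD _ _))//.
  rewrite normrZ (splitr e) ltrD//.
  rewrite (@le_lt_trans _ _ ((`|a| + 1) * `|w - c|)) ?ler_wpM2r ?lerDl//.
  by rewrite mulrC -ltr_pdivlMr.
have Hbnd z w : H z w -> `|w| <= `|z|.
  move=> Hzw; apply/ler_addgt0Pl => e e0.
  have [a [b [Gab za wb]]] := Hzw (e / 2) ltac:(by rewrite divr_gt0).
  have := Gbnd _ _ Gab.
  have := ler_normD (w - b) b; rewrite subrK.
  have := ler_normD (a - z) z; rewrite subrK (distrC a).
  lra.
have Huniq z w w' : H z w -> H z w' -> w = w'.
  move=> Hw Hw'; apply/eqP; rewrite -subr_eq0 -normr_le0.
  have := Hbnd _ _ (Hlin (- 1) _ _ _ _ Hw' Hw).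
  by rewrite !scaleN1r addrC (addrC _ z) subrr normr0.
have Hex z : exists w, H z w.
  have app n : {ab : E * F | G ab.1 ab.2 /\ `|z - ab.1| < n.+1%:R^-1}.
    apply: cid; have [] := Gdense (ball z n.+1%:R^-1).
    - by exists z; exact: ballxx.
    - exact: ball_open.
    by move=> a [+ [b Gab]]; rewrite -ball_normE/=; exists (a, b).
  pose a n := (sval (app n)).1; pose b n := (sval (app n)).2.
  have Gab n : G (a n) (b n) by case: (svalP (app n)).
  have za n : `|z - a n| < n.+1%:R^-1 by case: (svalP (app n)).
  have bD m n : `|b m - b n| <= `|a m - a n|.
    have := Gbnd _ _ (Glin (- 1) _ _ _ _ (Gab n) (Gab m)).
    by rewrite !scaleN1r ![- _ + _]addrC.
  have small e : 0 < e -> \forall n \near \oo, `|z - a n| < e.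
    move=> e0; near=> n; rewrite (lt_trans (za n))//.
    by near: n; exact: (near_infty_natSinv_lt (PosNum e0)).
  have : cauchy (b @ \oo).
    apply: cauchy_exP => e e0.
    have e20 : 0 < e / 2 by rewrite divr_gt0.
    have [N _ zN] := small _ e20.
    exists (b N); exists N => // n Nn; rewrite -ball_normE/=.
    rewrite (le_lt_trans (bD _ _))//.
    have := zN _ Nn; have := zN _ (leqnn N).
    by have := ler_distD z (a N) (a n); rewrite (distrC (a N) z); lra.
  move=> /cauchy_cvgP bcvg; exists (lim (b @ \oo)) => e e0.
  have : \forall n \near \oo, `|lim (b @ \oo) - b n| < e /\ `|z - a n| < e.
    apply: filterI; last exact: small.
    by move/cvgrPdist_lt: bcvg; apply.
  by move=> /filter_ex[n [? ?]]; exists (a n), (b n).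
have [T HT] := choice Hex.
have Tlin : linear T.
  by move=> a z z'; apply: Huniq (HT _) _; exact: Hlin.
pose T' := HB.pack_for {linear E -> F} T (GRing.isLinear.Build _ _ _ _ T Tlin).
exists T'; split => [z|z w Gzw]; first exact: (Hbnd _ _ (HT z)).
exact: Huniq (HT z) (GH _ _ Gzw).
Unshelve. all: by end_near. Qed.

(** * Linear spans, closed convex hulls and gauges *)

Lemma lspan_ind (R : realType) (V : lmodType R) (A P : set V) :
  P 0 -> (forall a u v, P u -> P v -> P (a *: u + v)) -> A `<=` P ->
  lspan A `<=` P.
Proof.
move=> P0 Plin AP; apply: smallest_sub => //; split.
  by apply/mem_set.
by move=> a u v /set_mem Pu /set_mem Pv; apply/mem_set/Plin.
Qed.

Lemma lspan0 (R : realType) (V : lmodType R) (A : set V) : lspan A 0.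
Proof. by move=> S [[S0 _] _]; exact: set_mem S0. Qed.

Lemma lspan_linear (R : realType) (V : lmodType R) (A : set V) a u v :
  lspan A u -> lspan A v -> lspan A (a *: u + v).
Proof.
move=> Au Av S [Slin AS].
by have := Slin.2 a u v (mem_set (Au _ (conj Slin AS)))
  (mem_set (Av _ (conj Slin AS))) => /set_mem.
Qed.

Lemma sub_lspan (R : realType) (V : lmodType R) (A : set V) : A `<=` lspan A.
Proof. exact: sub_gen_smallest. Qed.

Lemma lspanZ (R : realType) (V : lmodType R) (A : set V) a u :
  lspan A u -> lspan A (a *: u).
Proof. by rewrite -[a *: u]addr0 => Au; apply: lspan_linear => //; exact: lspan0. Qed.

Lemma lspanD (R : realType) (V : lmodType R) (A : set V) u v :
  lspan A u -> lspan A v -> lspan A (u + v).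
Proof. by move=> Au Av; rewrite -[u]scale1r; exact: lspan_linear. Qed.

Lemma convex_setP (R : realType) (V : lmodType R) (A : set V) :
  @convex_set R V A <-> forall t u v, 0 <= t -> t <= 1 -> A u -> A v ->
    A (t *: u + (1 - t) *: v).
Proof.
split => [cA t u v t0 t1 Au Av|cA u v t /set_mem Au /set_mem Av].
  have t01 : 0 <= t <= 1 by rewrite t0.
  have := cA u v (Itv01 t0 t1) (mem_set Au) (mem_set Av).
  by move=> /set_mem.
apply/mem_set; exact: (cA t%:num u v).
Qed.

Lemma closure_normP (R : realType) (E : normedModType R) (A : set E) z :
  closure A z <-> forall e, 0 < e -> exists2 a, A a & `|z - a| < e.
Proof.
split => [clz e e0|app B].
  have [a [Aa]] := clz _ (nbhsx_ballx z e e0).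
  by rewrite -ball_normE; exists a.
move=> /nbhs_ballP[e /= e0 eB]; have [a Aa za] := app _ e0.
by exists a; split => //; apply: eB; rewrite -ball_normE.
Qed.

Section ConvexHull.
Context (R : realType) (E : normedModType R).
Implicit Types A C : set E.

Lemma convex_conv_hull A : @convex_set R E (conv_hull A).
Proof.
apply/convex_setP => t u v t0 t1 Au Av C [/[dup]/convex_setP cC Cconv AC].
by apply: cC => //; [exact: Au|exact: Av].
Qed.

Lemma convex_closed_conv_hull A : @convex_set R E (closed_conv_hull A).
Proof.
apply/convex_setP => t u v t0 t1 /closure_normP Au /closure_normP Av.
apply/closure_normP => e e0.
have [a Aa ua] := Au _ e0; have [b Ab vb] := Av _ e0.
exists (t *: a + (1 - t) *: b).
  exact: (convex_setP _).1 (@convex_conv_hull A) _ _ _ t0 t1 Aa Ab.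
rewrite opprD addrACA -!scalerBr (le_lt_trans (ler_normD _ _))//.
rewrite !normrZ (ger0_norm t0) ger0_norm ?subr_ge0//.
by have := t0; rewrite le_eqVlt => /predU1P[<-|?]; nra.
Qed.

Lemma sub_closed_conv_hull A : A `<=` closed_conv_hull A.
Proof.
by move=> a Aa; apply: subset_closure; apply: sub_gen_smallest.
Qed.

Lemma closed_conv_hull_min A C :
  closed C -> @convex_set R E C -> A `<=` C -> closed_conv_hull A `<=` C.
Proof.
move=> clC cC AC z /(closure_subset (smallest_sub cC AC)).
by rewrite -(closure_id _).1.
Qed.

End ConvexHull.

(** * The spaces Y_t *)

Section Gauge.
Context (R : realType) (X : completeNormedModType R) (x : nat -> X).

Definition vertex (t : R) (n : nat) : X := (`|x n| `^ t)^-1 *: x n.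

Lemma Uset_vertex t n : Uset x t (vertex t n).
Proof. by apply: sub_closed_conv_hull; left; exists n. Qed.

Lemma Uset_convex t a u v : 0 <= a -> a <= 1 -> Uset x t u -> Uset x t v ->
  Uset x t (a *: u + (1 - a) *: v).
Proof.
move=> a0 a1 Uu Uv.
have cU : @convex_set R X (Uset x t) by exact: convex_closed_conv_hull.
exact: (convex_setP (Uset x t)).1 cU _ _ _ a0 a1 Uu Uv.
Qed.

Lemma closed_Uset t : closed (Uset x t).
Proof. exact: closed_closure. Qed.

Lemma Uset_min t (C : set X) : closed C -> @convex_set R X C ->
  (forall n, C (vertex t n)) -> (forall z, C z -> C (- z)) ->
  Uset x t `<=` C.
Proof.
move=> clC cC Cx CN; apply: closed_conv_hull_min => // _ [[n _ <-]|[n _ <-]].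
  exact: Cx.
exact/CN/Cx.
Qed.

Lemma convex_oppr (C : set X) :
  @convex_set R X C -> @convex_set R X [set z | C (- z)].
Proof.
move=> /convex_setP cC; apply/convex_setP => a u v a0 a1 Cu Cv /=.
by rewrite opprD -!scalerN; exact: cC.
Qed.

Lemma UsetN t z : Uset x t z -> Uset x t (- z).
Proof.
apply: (@closed_conv_hull_min _ _ _ [set z | Uset x t (- z)]).
- apply: (@closed_comp _ _ (fun z : X => - z)); last exact: closed_Uset.
  by move=> y _; exact: opp_continuous.
- exact/convex_oppr/convex_closed_conv_hull.
- move=> _ [[n _ <-]|[n _ <-]]/=; apply: sub_closed_conv_hull.
    by right; exists n.
  by left; exists n => //; rewrite opprK.
Qed.

Lemma Uset0 t : Uset x t 0.
Proof.
have U0 := @Uset_vertex t 0.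
have := @Uset_convex t 2^-1 _ _ _ _ U0 (UsetN U0).
rewrite scalerN -scalerBl (_ : 2^-1 - _ = 0) ?scale0r; last by lra.
by apply; lra.
Qed.

Lemma Uset_scale t a z : `|a| <= 1 -> Uset x t z -> Uset x t (a *: z).
Proof.
wlog a0 : a z / 0 <= a.
  move=> H a1 Uz; have [a0|a0] := leP 0 a; first exact: H.
  rewrite -[a]opprK scaleNr -scalerN; apply: H; rewrite ?normrN//.
    by rewrite oppr_ge0 ltW.
  exact: UsetN.
rewrite ger0_norm// => a1 Uz.
by have := Uset_convex a0 a1 Uz (Uset0 t); rewrite scaler0 addr0.
Qed.

(** Comparing gauges through membership in c U_t keeps the infimum out of the
    proofs. *)
Definition dilate (t c : R) (z : X) : Prop := 0 < c /\ Uset x t (c^-1 *: z).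

Lemma dilateD t c d u v : dilate t c u -> dilate t d v -> dilate t (c + d) (u + v).
Proof.
move=> [c0 Uu] [d0 Uv]; have cd0 : 0 < c + d by rewrite addr_gt0.
split => //; have c_ge0 : 0 <= c / (c + d) by rewrite divr_ge0// ltW.
have c_le1 : c / (c + d) <= 1 by rewrite ler_pdivrMr// mul1r lerDl ltW.
have := Uset_convex c_ge0 c_le1 Uu Uv.
rewrite (_ : 1 - c / (c + d) = d / (c + d)); last by field; rewrite gt_eqF.
rewrite !scalerA ![_ / (c + d)]mulrC -!mulrA !mulfV ?gt_eqF// mulr1.
by rewrite scalerDr.
Qed.

Lemma dilateW t c d z : c <= d -> dilate t c z -> dilate t d z.
Proof.
move=> cd [c0 Uz]; have d0 : 0 < d by rewrite (lt_le_trans c0).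
split=> //; rewrite (_ : d^-1 *: z = (c / d) *: (c^-1 *: z)).
  apply: Uset_scale => //.
  rewrite ger0_norm; first by rewrite ler_pdivrMr// mul1r.
  by rewrite divr_ge0// ltW.
by rewrite scalerA mulrAC mulfV ?mul1r// gt_eqF.
Qed.

Lemma dilateZ t c a z : a != 0 -> dilate t c z -> dilate t (`|a| * c) (a *: z).
Proof.
move=> a0 [c0 Uz]; have a_gt0 : 0 < `|a| by rewrite normr_gt0.
split; first exact: mulr_gt0.
rewrite (_ : _ *: (a *: z) = (a / `|a|) *: (c^-1 *: z)).
  by apply: Uset_scale => //; rewrite normrM normfV normr_id mulfV ?gt_eqF.
by rewrite !scalerA invfM; congr (_ *: _); ring.
Qed.

Lemma dilate0 t c : 0 < c -> dilate t c 0.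
Proof. by move=> c0; split => //; rewrite scaler0; exact: Uset0. Qed.

Lemma YspaceP t z : Yspace x t z <-> exists c, dilate t c z.
Proof.
split.
  apply: (@lspan_ind _ _ (Uset x t) [set z | exists c, dilate t c z]).
  - by exists 1; exact: dilate0.
  - move=> a u v [c cu] [d dv]; have [->|a0] := eqVneq a 0.
      by rewrite scale0r add0r; exists d.
    by exists (`|a| * c + d); apply: dilateD => //; exact: dilateZ.
  - by move=> {}z Uz; exists 1; split => //; rewrite invr1 scale1r.
move=> [c [c0 Uz]]; rewrite -[z]scale1r -(@mulfV _ c) ?gt_eqF// -scalerA.
by apply: lspanZ; exact: sub_lspan.
Qed.

Lemma Ynorm_le t c z : dilate t c z -> Ynorm x t z <= c.
Proof.
move=> [c0 Uz]; apply: ge_inf; last first.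
  by exists c; rewrite /= ?gtr0_norm// gt_eqF.
by exists 0 => _ [l _ <-].
Qed.

Lemma Ynorm_lt t c z : Yspace x t z -> Ynorm x t z < c -> dilate t c z.
Proof.
move=> /YspaceP[d [d0 Uz]] zc.
have [] := @inf_lt _ [set `|l| | l in [set l : R | l != 0 /\ Uset x t (l^-1 *: z)]] c _ zc.
  by exists `|d|, d => //; split => //; rewrite gt_eqF.
move=> _ [l [l0 Ul] <-] lc; apply: (dilateW (ltW lc)).
split; first by rewrite normr_gt0.
rewrite (_ : _ *: z = (l / `|l|) *: (l^-1 *: z)).
  by apply: Uset_scale => //; rewrite normrM normfV normr_id mulfV ?normr_eq0.
by rewrite scalerA mulrAC mulfV ?mul1r.
Qed.

Lemma Ynorm_ge0 t z : 0 <= Ynorm x t z.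
Proof.
rewrite /Ynorm; set A := (X in inf X).
have [->|/set0P A0] := eqVneq A set0; first by rewrite inf0.
by apply: lb_le_inf => // _ [l _ <-].
Qed.

Lemma Ynorm_le_eps t c z :
  (forall e, 0 < e -> dilate t (c + e) z) -> Ynorm x t z <= c.
Proof. by move=> H; apply/ler_addgt0Pr => e e0; exact/Ynorm_le/H. Qed.

Lemma Ynorm0 t : Ynorm x t 0 = 0.
Proof.
apply/eqP; rewrite eq_le Ynorm_ge0 andbT; apply: Ynorm_le_eps => e e0.
by rewrite add0r; exact: dilate0.
Qed.

Lemma YnormD t u v : Yspace x t u -> Yspace x t v ->
  Ynorm x t (u + v) <= Ynorm x t u + Ynorm x t v.
Proof.
move=> Yu Yv; apply: Ynorm_le_eps => e e0.
rewrite (splitr e) addrACA; have e20 : 0 < e / 2 by rewrite divr_gt0.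
by apply: dilateD; apply: Ynorm_lt; rewrite ?ltrDl.
Qed.

Lemma YnormZ_le t a u : Yspace x t u ->
  Ynorm x t (a *: u) <= `|a| * Ynorm x t u.
Proof.
move=> Yu; have [->|a0] := eqVneq a 0.
  by rewrite scale0r Ynorm0 normr0 mul0r.
apply: Ynorm_le_eps => e e0.
rewrite (_ : _ + e = `|a| * (Ynorm x t u + e / `|a|)).
  have a_gt0 : 0 < `|a| by rewrite normr_gt0.
  by apply: dilateZ => //; apply: Ynorm_lt => //; rewrite ltrDl; exact: divr_gt0.
by field; rewrite normr_eq0.
Qed.

Context (x_neq0 : forall n, x n != 0) (x_le1 : forall n, `|x n| <= 1).

Lemma vertex_monotone s t n :
  vertex s n = (`|x n| `^ (t - s)) *: vertex t n.
Proof.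
rewrite /vertex scalerA; congr (_ *: _).
have xt0 : `|x n| `^ t != 0 by rewrite gt_eqF// powR_gt0// normr_gt0.
by rewrite powRB ?normr_eq0 ?x_neq0 ?implybT// mulrAC mulfV ?mul1r.
Qed.

(** The vertices of U_s are those of U_t scaled by |x_n|^(t - s) <= 1. *)
Lemma Uset_subset s t : s <= t -> Uset x s `<=` Uset x t.
Proof.
move=> st; apply: Uset_min.
- exact: closed_Uset.
- exact: convex_closed_conv_hull.
- move=> n; rewrite (vertex_monotone s t); apply: Uset_scale.
    rewrite ger0_norm ?powR_ge0// -[leRHS](powRr0 `|x n|) ger_powR ?subr_ge0//.
    by rewrite normr_gt0 x_neq0 x_le1.
  exact: Uset_vertex.
- exact: UsetN.
Qed.

Lemma Yspace_subset s t : s <= t -> Yspace x s `<=` Yspace x t.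
Proof.
move=> st z /YspaceP[c [c0 Uz]]; apply/YspaceP; exists c; split => //.
exact: Uset_subset Uz.
Qed.

Lemma Ynorm_nonincreasing s t z : s <= t -> Yspace x s z ->
  Ynorm x t z <= Ynorm x s z.
Proof.
move=> st Yz; apply: Ynorm_le_eps => e e0.
have [c0 Uz] : dilate s (Ynorm x s z + e) z by apply: Ynorm_lt; rewrite ?ltrDl.
by split=> //; exact: Uset_subset Uz.
Qed.

End Gauge.

(** * Compactness of the inclusions Y_s in Y_t *)

Section CompactInclusion.
Context (R : realType) (X : completeNormedModType R) (x : nat -> X).
Context (x_neq0 : forall n, x n != 0) (x_le1 : forall n, `|x n| <= 1).
Context (x_cvg0 : (fun n => `|x n|) @ \oo --> (0 : R)).

(** This is the compactness of the inclusion of Y_s in Y_t, in a form that does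
    not mention the topology of Y_t. All but finitely many of the vertices
    x_n / |x_n|^s of U_s lie in e U_t. As a compact set plus a closed set, the
    right-hand side is closed in X, so it contains the closed convex hull. *)
Lemma Uset_zonotope_addition s t e : s < t -> 0 < e ->
  exists M, Uset x s `<=` [set a + b | a in zonotope 1 (vertex x s) M &
                                       b in [set b | Uset x t (e^-1 *: b)]].
Proof.
move=> st e0; have ts0 : 0 < t - s by rewrite subr_gt0.
have [M _ small] : \forall n \near \oo, `|x n| `^ (t - s) <= e.
  have e1 : 0 < e `^ (t - s)^-1 by rewrite powR_gt0.
  move/cvgrPdist_lt: x_cvg0 => /(_ _ e1); apply: filterS => n.
  rewrite sub0r normrN normr_id => /ltW xn.
  rewrite -[leRHS](powRr1 (ltW e0)) -(@mulVf _ (t - s)) ?gt_eqF// powRrM.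
  by rewrite ge0_ler_powR// ?nnegrE ?powR_ge0// ltW.
exists M; apply: Uset_min.
- apply: closed_compact_addition; first exact: compact_zonotope.
  apply: (@closed_comp _ _ (fun z : X => e^-1 *: z)); last exact: closed_Uset.
  by move=> y _; exact: scaler_continuous.
- apply/convex_setP => a _ _ a0 a1 [_ [c c1 ->] [u Uu <-]] [_ [d d1 ->] [v Uv <-]].
  exists (\sum_(i < M) (a * c i + (1 - a) * d i) *: vertex x s i).
    exists (fun i => a * c i + (1 - a) * d i) => // i.
    rewrite (le_trans (ler_normD _ _))// !normrM (ger0_norm a0).
    rewrite (@ger0_norm _ (1 - a)) ?subr_ge0//.
    by have := c1 i; have := d1 i; nra.
  exists (a *: u + (1 - a) *: v).
    rewrite /= scalerDr !scalerA ![e^-1 * _]mulrC -!scalerA.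
    exact: Uset_convex.
  rewrite !scalerDr addrACA; congr (_ + _).
  rewrite !scaler_sumr -big_split/=; apply: eq_bigr => i _.
  by rewrite scalerDl !scalerA.
- move=> n; have [nM|Mn] := ltnP n M.
    exists (vertex x s n); last by exists 0; rewrite ?addr0//= scaler0; exact: Uset0.
    exists (fun i => (i == n)%:R).
      by move=> i; case: eqP => _; rewrite ?normr1 ?normr0.
    rewrite (bigD1 (Ordinal nM))//= eqxx scale1r big1 ?addr0// => i /negPf.
    by rewrite -val_eqE/= => ->; rewrite scale0r.
  exists 0.
    by exists (fun=> 0) => [i|]; rewrite ?normr0// big1// => i _; rewrite scale0r.
  exists (vertex x s n); rewrite ?add0r//= (vertex_monotone x_neq0 s t) scalerA.
  apply: Uset_scale; last exact: Uset_vertex.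
  rewrite ger0_norm ?mulr_ge0 ?powR_ge0 ?invr_ge0 ?(ltW e0)//.
  by rewrite mulrC ler_pdivrMr// mul1r small.
- move=> _ [_ [c c1 ->] [u Uu <-]].
  exists (\sum_(i < M) (- c i) *: vertex x s i).
    by exists (fun i => - c i) => // i; rewrite normrN.
  exists (- u); first by rewrite /= scalerN; exact: UsetN.
  rewrite opprD -sumrN; congr (_ + _).
  by apply: eq_bigr => i _; rewrite scaleNr.
Qed.

End CompactInclusion.

(** * Induction over intervals *)

(** Cutting at the points of S and bisecting reaches intervals that are shorter
    than d and free of points of S; this replaces partitions and sums over
    their cells. *)
Lemma interval_induction (R : realType) (Q : R -> R -> Prop) (S : seq R)
    (d u v : R) : 0 < d -> u < v ->
  (forall a b c, u <= a -> a < b -> b < c -> c <= v ->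
    Q a b -> Q b c -> Q a c) ->
  (forall a b, u <= a -> a < b -> b <= v -> b - a < d ->
    {in S, forall s, ~~ (a < s < b)} -> Q a b) ->
  Q u v.
Proof.
move=> d0 uv Qcat Qbase.
have short a b : u <= a -> a < b -> b <= v -> b - a < d -> Q a b.
  elim: S Qbase a b => [|s S IH] Qbase a b ua ab bv abd; first exact: Qbase.
  apply: IH => // {ua bv abd}a {ab}b ua ab bv abd abS.
  have [/andP[as_ sb]|asb] := boolP (a < s < b).
    apply: (Qcat a s b) => //; apply: Qbase => //; try lra.
      move=> z; rewrite inE => /predU1P[->|/abS]; first by rewrite ltxx andbF.
      by apply: contraNN => /andP[-> /lt_trans]; exact.
    move=> z; rewrite inE => /predU1P[->|/abS]; first by rewrite ltxx.
    by apply: contraNN => /andP[/(lt_trans as_) -> ->].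
  by apply: Qbase => // z; rewrite inE => /predU1P[->|/abS].
have [n nd] : exists n : nat, v - u < 2 ^+ n * d.
  exists (Num.truncn ((v - u) / d)).+1; rewrite -ltr_pdivrMr//.
  rewrite (lt_le_trans (truncnS_gt _))// -natrX ler_nat.
  exact/ltnW/ltn_expl.
elim: n u v uv {Qbase} Qcat short nd => [|n IH] a b ab Qcat short.
  by rewrite expr0 mul1r; exact: short.
rewrite exprS => nd; apply: (Qcat _ ((a + b) / 2)); try lra.
  by apply: IH; [lra|move=> a' b' c' *; apply: (Qcat a' b' c') => //; lra|
    move=> *; apply: short => //; lra|lra].
by apply: IH; [lra|move=> a' b' c' *; apply: (Qcat a' b' c') => //; lra|
  move=> *; apply: short => //; lra|lra].
Qed.

Lemma nonincreasing_on_itv_measurable (R : realType) (u v : R) (f : R -> R) :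
  {in `]u, v[ &, {homo f : r s / r <= s >-> s <= r}} ->
  measurable_fun `]u, v[ f.
Proof.
move=> fni; apply: (measurability (@RGenCInfty.G R)) => [|/= _ [_] [c] -> <-].
  exact: RGenCInfty.measurableE.
apply: is_interval_measurable => s t/= [sI _] [tI ft] r /andP[sr rt].
have rI : r \in `]u, v[ by move: sI tI; rewrite !in_itv/=; lra.
split => //; move: ft; rewrite !in_itv/= !andbT => /le_trans; apply.
exact: fni.
Qed.

(** * Step functions *)

Section StepFunctions.
Context (R : realType) (X : completeNormedModType R) (x : nat -> X).
Context (x_neq0 : forall n, x n != 0) (x_le1 : forall n, `|x n| <= 1).
Implicit Types (f : R -> X) (y : X).

Lemma step_linear s t a u v :
  step s t (a *: u + v) = a *: step s t u + step s t v :> (R -> X).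
Proof.
apply/funext => r; rewrite /step !fctE.
by case: ifP => // _; rewrite scaler0 addr0.
Qed.

Lemma stepZ s t a u : step s t (a *: u) = a *: step s t u :> (R -> X).
Proof.
by apply/funext => r; rewrite /step !fctE; case: ifP => // _; rewrite scaler0.
Qed.

Lemma step_ge s t y : t <= s -> step s t y = 0 :> (R -> X).
Proof.
by move=> ts; apply/funext => r; rewrite /step; case: ifP => // srt; exfalso; lra.
Qed.

Lemma Zpre_step s p q y : 0 < s -> s <= p -> q < 1 -> Yspace x s y ->
  Zpre x (step p q y).
Proof.
move=> s0 sp q1 Yy; have [pq|qp] := ltP p q; last first.
  by rewrite step_ge//; exact: lspan0.
apply: sub_lspan; exists p, q, y; split => //; first exact: lt_le_trans sp.
exact: Yspace_subset Yy.
Qed.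

Lemma Zpre_Yspace f r : Zpre x f -> 0 < r -> Yspace x r (f r).
Proof.
move=> + r0; move: f; apply: (@lspan_ind _ _ _ [set f : R -> X | Yspace x r (f r)]).
- exact: lspan0.
- by move=> a f g Yf Yg; exact: lspan_linear.
- move=> _ [s [t [y [s0 st t1 Yy ->]]]] /=; rewrite /step.
  case: ifP => [/andP[sr _]|_]; last exact: lspan0.
  by apply: Yspace_subset Yy => //; exact: ltW.
Qed.

(** The triple (s, t, y) stands for the step of value y on (s, t). *)
Definition step_data (g : R * R * X) : Prop :=
  [/\ 0 < g.1.1, g.1.1 < g.1.2, g.1.2 < 1 & Yspace x g.1.1 g.2].

Definition step_sum (l : seq (R * R * X)) : R -> X :=
  \sum_(g <- l) step g.1.1 g.1.2 g.2.

Lemma step_sumE l r : step_sum l r = \sum_(g <- l) step g.1.1 g.1.2 g.2 r.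
Proof. by rewrite /step_sum; elim/big_rec2: _ => // g a f _ <-. Qed.

Definition scale_data (a : R) (g : R * R * X) := (g.1, a *: g.2).

Lemma scale_step_data a g : step_data g -> step_data (scale_data a g).
Proof. by case=> *; split => //; exact: lspanZ. Qed.

Lemma step_sum_linear a l l' :
  step_sum (map (scale_data a) l ++ l') = a *: step_sum l + step_sum l'.
Proof.
rewrite /step_sum big_cat big_map scaler_sumr; congr (_ + _).
by apply: eq_bigr => g _; rewrite stepZ.
Qed.

Lemma Zpre_step_sum l : {in l, forall g, step_data g} -> Zpre x (step_sum l).
Proof.
elim: l => [|g l IH] lP; first by rewrite /step_sum big_nil; exact: lspan0.
rewrite /step_sum big_cons; apply: lspanD.
  have [? ? ? ?] := lP g (mem_head _ _).
  by apply: sub_lspan; exists g.1.1, g.1.2, g.2.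
by apply: IH => h hl; apply: lP; rewrite inE hl orbT.
Qed.

Lemma ZpreP f : Zpre x f <->
  exists2 l, {in l, forall g, step_data g} & f = step_sum l.
Proof.
split=> [|[l lP ->]]; last exact: Zpre_step_sum.
apply: (@lspan_ind _ _ _ [set f |
    exists2 l, {in l, forall g, step_data g} & f = step_sum l]).
- by exists [::] => //; rewrite /step_sum big_nil.
- move=> a _ _ [l lP ->] [l' l'P ->]; exists (map (scale_data a) l ++ l').
    move=> g; rewrite mem_cat => /orP[/mapP[h hl ->]|]; last exact: l'P.
    exact/scale_step_data/lP.
  by rewrite step_sum_linear.
- move=> _ [s [t [y [? ? ? ? ->]]]]; exists [:: (s, t, y)].
    by move=> g; rewrite inE => /eqP ->.
  by rewrite /step_sum big_seq1.
Qed.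

Definition endpoints (l : seq (R * R * X)) : seq R :=
  map (fun g => g.1.1) l ++ map (fun g => g.1.2) l.

Lemma endpoints_notin l u v : {in endpoints l, forall s, ~~ (u < s < v)} ->
  forall g, g \in l -> ~~ (u < g.1.1 < v) /\ ~~ (u < g.1.2 < v).
Proof.
move=> lS g gl; split; apply: lS; rewrite mem_cat.
  by rewrite (map_f (fun g : R * R * X => g.1.1) gl).
by rewrite (map_f (fun g : R * R * X => g.1.2) gl) orbT.
Qed.

Lemma step_sum_constant l u v r m :
  {in endpoints l, forall s, ~~ (u < s < v)} ->
  u < r < v -> u < m < v -> step_sum l r = step_sum l m.
Proof.
move=> /endpoints_notin lS ur um; rewrite !step_sumE.
apply: eq_big_seq => g /lS[gl gr]; rewrite /step.
suff -> : (g.1.1 < r < g.1.2) = (g.1.1 < m < g.1.2) by [].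
by apply/idP/idP; lra.
Qed.

(** Between consecutive endpoints f is constant, and the gauge of a fixed vector
    is monotone in time. *)
Lemma measurable_Ynorm f (u v : R) : Zpre x f -> 0 <= u -> u < v -> v <= 1 ->
  measurable_fun `]u, v[ (fun r => Ynorm x r (f r)).
Proof.
move=> Zf u0 uv v1; have /ZpreP[l lP fE] := Zf.
apply: (@interval_induction R (fun u v => measurable_fun `]u, v[
  (fun r => Ynorm x r (f r))) (endpoints l) 2 u v) => //.
  move=> a b c ua ab bc cv mab mbc.
  have -> : `]a, c[%classic = `]a, b[ `|` [set b] `|` `]b, c[ :> set R.
    apply/seteqP; split => [r|r [[|]|]]/=; rewrite ?in_itv/=.
    - by move=> /andP[ar rc]; case: (ltgtP r b) => [|?|->]; [left;left|right|left;right] => //; rewrite ?in_itv/=; lra.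
    - lra.
    - by move=> ->; lra.
    - lra.
  apply/measurable_funU => //; first exact: measurableU.
  split => //; apply/measurable_funU => //; split => //.
  exact: measurable_fun_set1.
move=> a b ua ab bv _ lS.
apply: nonincreasing_on_itv_measurable => r s; rewrite !in_itv/= => ar as_ rs.
rewrite fE (step_sum_constant lS as_ ar); apply: Ynorm_nonincreasing => //.
by rewrite -fE; apply: Zpre_Yspace => //; lra.
Qed.

Lemma measurable_Ynorm_EFin f (u v : R) : Zpre x f -> 0 <= u -> u < v -> v <= 1 ->
  measurable_fun `]u, v[ (fun r => (Ynorm x r (f r))%:E).
Proof. by move=> *; apply/measurable_EFinP; exact: measurable_Ynorm. Qed.

Definition Znorm_on (u v : R) f : \bar R :=
  (\int[lebesgue_measure]_(r in `]u, v[) (Ynorm x r (f r))%:E)%E.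

Lemma Znorm_on_cat f (a b c : R) : Zpre x f -> 0 <= a -> a < b -> b < c -> c <= 1 ->
  (Znorm_on a b f + Znorm_on b c f <= Znorm_on a c f)%E.
Proof.
move=> Zf a0 ab bc c1.
have sub : `]a, b[ `|` `]b, c[ `<=` (`]a, c[ : set R).
  by move=> r [|]/=; rewrite !in_itv/=; lra.
have m := @measurable_Ynorm_EFin f a c Zf a0 (lt_trans ab bc) c1.
rewrite /Znorm_on -ge0_integral_setU//.
- by apply: ge0_subset_integral => //; [exact: measurableU|move=> r _; rewrite lee_fin Ynorm_ge0].
- exact: measurable_funS m.
- by move=> r _; rewrite lee_fin Ynorm_ge0.
- by apply/disj_setPS => r []/=; rewrite !in_itv/=; lra.
Qed.

Lemma Znorm_on_le f (u v : R) : Zpre x f -> 0 <= u -> u < v -> v <= 1 ->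
  (Znorm_on u v f <= Zpre_norm x f)%E.
Proof.
move=> Zf u0 uv v1; apply: ge0_subset_integral => //.
- exact: measurable_Ynorm_EFin.
- by move=> r _; rewrite lee_fin Ynorm_ge0.
- by move=> r/=; rewrite !in_itv/=; lra.
Qed.

Lemma Znorm_on_ge f (u v c : R) : Zpre x f -> 0 <= u -> u < v -> v <= 1 -> 0 <= c ->
  (forall r, u < r < v -> c <= Ynorm x r (f r)) ->
  (((v - u) * c)%:E <= Znorm_on u v f)%E.
Proof.
move=> Zf u0 uv v1 c0 cf.
have -> : ((v - u) * c)%:E =
    (\int[lebesgue_measure]_(r in `]u, v[) (cst c%:E r))%E.
  by rewrite integral_cst//= lebesgue_measure_itv/= lte_fin uv -EFinD -EFinM mulrC.
apply: ge0_le_integral => //.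
exact: measurable_Ynorm_EFin.
Qed.

Lemma Zpre_norm_step (s p q : R) y : 0 < s -> s <= p -> p <= q -> q < 1 ->
  Yspace x s y -> (Zpre_norm x (step p q y) <= ((q - p) * Ynorm x s y)%:E)%E.
Proof.
move=> s0 sp pq q1 Yy; have Zf := Zpre_step s0 sp q1 Yy.
rewrite /Zpre_norm.
have -> : (\int[lebesgue_measure]_(r in `]0%R, 1%R[) (Ynorm x r (step p q y r))%:E =
  \int[lebesgue_measure]_(r in `]p, q[) (Ynorm x r (step p q y r))%:E)%E.
  rewrite integral_mkcond [RHS]integral_mkcond; apply: eq_integral => r _.
  rewrite !patchE !mem_setE !in_itv/= /step.
  have [rpq|_] := boolP (p < r < q); last by rewrite Ynorm0; case: ifP.
  by rewrite ifT//; lra.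
have [pq'|qp] := ltP p q; last first.
  by rewrite set_itv_ge ?integral_set0 ?lee_fin ?mulr_ge0 ?Ynorm_ge0 ?subr_ge0// bnd_simp -leNgt.
have -> : ((q - p) * Ynorm x s y)%:E =
    (\int[lebesgue_measure]_(r in `]p, q[) (cst (Ynorm x s y)%:E r))%E.
  by rewrite integral_cst//= lebesgue_measure_itv/= lte_fin pq' -EFinD -EFinM mulrC.
apply: ge0_le_integral => //.
- by move=> r _; rewrite lee_fin Ynorm_ge0.
- by apply: measurable_Ynorm_EFin => //; lra.
- move=> r/=; rewrite in_itv/= lee_fin => rpq; rewrite /step rpq.
  by apply: Ynorm_nonincreasing => //; lra.
Qed.

End StepFunctions.

(** * The embedding of step functions in Z *)

Section Completion.
Context (R : realType) (X : completeNormedModType R) (x : nat -> X).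
Context (x_neq0 : forall n, x n != 0) (x_le1 : forall n, `|x n| <= 1).
Context (Z : completeNormedModType R) (J : (R -> X) -> Z).
Context (hZ : is_Z_completion x J).
Implicit Types (f : R -> X) (y : X) (l : seq (R * R * X)).

Let Jlin a f g : Zpre x f -> Zpre x g -> J (a *: f + g) = a *: J f + J g.
Proof. exact: completion_linear. Qed.

Lemma J0 : J 0 = 0.
Proof.
have := @Jlin 1 0 0 (@lspan0 _ _ _) (@lspan0 _ _ _).
by rewrite scaler0 addr0 scale1r => /(congr1 (fun z => z - J 0)); rewrite addrK subrr.
Qed.

Lemma JD f g : Zpre x f -> Zpre x g -> J (f + g) = J f + J g.
Proof. by move=> Zf Zg; rewrite -[f]scale1r Jlin// !scale1r. Qed.

Lemma JZ a f : Zpre x f -> J (a *: f) = a *: J f.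
Proof. by move=> Zf; rewrite -[a *: f]addr0 Jlin ?J0 ?addr0//; exact: lspan0. Qed.

Lemma dense_J z e : 0 < e -> exists2 f, Zpre x f & `|z - J f| < e.
Proof.
move=> e0; have [] := @completion_dense _ _ _ _ _ hZ (ball z e).
- by exists z; exact: ballxx.
- exact: ball_open.
by move=> z' [+ [f Zf fz']]; rewrite -ball_normE -fz'; exists f.
Qed.

Lemma norm_J_step (s p q : R) y : 0 < s -> s <= p -> p <= q -> q < 1 ->
  Yspace x s y -> `|J (step p q y)| <= (q - p) * Ynorm x s y.
Proof.
move=> s0 sp pq q1 Yy; rewrite -lee_fin (completion_isometry hZ).
  exact: Zpre_norm_step.
exact: (Zpre_step x_neq0 x_le1 s0).
Qed.

(** The two sides differ at the single time b. *)
Lemma J_step_cat (s a b c : R) y : 0 < s -> s <= a -> a <= b -> b <= c ->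
  c < 1 -> Yspace x s y ->
  J (step a b y) + J (step b c y) = J (step a c y).
Proof.
move=> s0 sa ab bc c1 Yy.
have Zab : Zpre x (step a b y) by apply: (Zpre_step x_neq0 x_le1 s0) => //; lra.
have Zbc : Zpre x (step b c y) by apply: (Zpre_step x_neq0 x_le1 s0) => //; lra.
have Zac : Zpre x (step a c y) by apply: (Zpre_step x_neq0 x_le1 s0) => //; lra.
rewrite -JD//; apply/(completion_ae hZ) => //; first exact: lspanD.
exists [set b]; split => //; first exact: lebesgue_measure_set1.
move=> r /=; apply: contra_notP => /eqP rb _.
rewrite fctE /step; have {rb} : (r < b) || (b < r) by rewrite -neq_lt.
case/orP => rb.
- rewrite rb (_ : b < r < c = false) ?addr0 ?(lt_le_trans rb bc)//.
  by rewrite ltNge ltW.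
- rewrite rb (_ : a < r < b = false) ?add0r ?(le_lt_trans ab rb)//.
  by rewrite andbC ltNge ltW.
Qed.

Lemma J_step_sum (s p q : R) (n : nat) (c : nat -> R) (w : nat -> X) :
  0 < s -> s <= p -> q < 1 -> (forall i, Yspace x s (w i)) ->
  J (step p q (\sum_(i < n) c i *: w i)) = \sum_(i < n) c i *: J (step p q (w i)).
Proof.
move=> s0 sp q1 Yw; pose Zs y := @Zpre_step R X x x_neq0 x_le1 s p q y s0 sp q1.
suff [] : Yspace x s (\sum_(i < n) c i *: w i) /\
  J (step p q (\sum_(i < n) c i *: w i)) = \sum_(i < n) c i *: J (step p q (w i)) by [].
elim: n => [|n [IHY IH]].
  rewrite !big_ord0; split; first exact: lspan0.
  by rewrite -(scale0r 0) stepZ scale0r J0.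
rewrite !big_ord_recr/= [_ + _ *: w n]addrC; split.
  by apply: lspan_linear; [exact: Yw|exact: IHY].
by rewrite step_linear Jlin; [rewrite IH; exact: addrC|exact: Zs|exact: Zs].
Qed.

(** * Averages of step functions over a cell *)

Definition clamp (s t u : R) : R := Num.min t (Num.max s u).

(** The integral of [step_sum l] over (p, q), without Bochner integration: the
    length of the part of (s, t) in (p, q) is a difference of values of
    [clamp s t], so that additivity in the cell is a telescoping. *)
Definition cell_integral l (p q : R) : X :=
  \sum_(g <- l) (clamp g.1.1 g.1.2 q - clamp g.1.1 g.1.2 p) *: g.2.

Lemma clamp_le s t a : s < t -> a <= s -> clamp s t a = s.
Proof. by move=> st /max_idPl; rewrite /clamp => ->; apply/min_idPr/ltW. Qed.

Lemma clamp_ge s t a : s < t -> t <= a -> clamp s t a = t.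
Proof.
move=> st ta; rewrite /clamp; have /max_idPr -> : s <= a by lra.
by apply/min_idPl.
Qed.

Lemma clamp_id s t a : s <= a -> a <= t -> clamp s t a = a.
Proof. by rewrite /clamp => /max_idPr -> /min_idPr. Qed.

Lemma clamp_monotone s t a b : a <= b -> clamp s t a <= clamp s t b.
Proof. by move=> ab; rewrite /clamp le_min2// le_max2. Qed.

Lemma clamp_itv s t a : s < t -> s <= clamp s t a <= t.
Proof.
by move=> st; rewrite /clamp le_min ge_min le_max !lexx ltW.
Qed.

Lemma clamp_cell s t a b : s < t -> a < b -> ~~ (a < s < b) -> ~~ (a < t < b) ->
  [\/ [/\ s <= a & b <= t], clamp s t a = s /\ clamp s t b = s /\ b <= s |
      clamp s t a = t /\ clamp s t b = t /\ t <= a].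
Proof.
move=> st ab sab tab; have [sa|as_] := leP s a.
  have [bt|tb] := leP b t; first exact: Or31.
  by apply: Or33; rewrite !clamp_ge//; lra.
by apply: Or32; rewrite !clamp_le//; lra.
Qed.

Lemma cell_integral_cat l a b c :
  cell_integral l a b + cell_integral l b c = cell_integral l a c.
Proof.
rewrite -big_split/=; apply: eq_bigr => g _.
by rewrite -scalerDl; congr (_ *: _); ring.
Qed.

Lemma cell_integral_constant l a b m : {in l, forall g, step_data x g} ->
  a < m < b -> {in endpoints l, forall s, ~~ (a < s < b)} ->
  cell_integral l a b = (b - a) *: step_sum l m.
Proof.
move=> lP amb /endpoints_notin lS; rewrite step_sumE scaler_sumr.
apply: eq_big_seq => g gl; have [sab tab] := lS g gl; have [_ st _ _] := lP g gl.
have ab : a < b by lra.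
rewrite /step; have [[sa bt]|[-> [-> bs]]|[-> [-> ta]]] := clamp_cell st ab sab tab.
- have -> : clamp g.1.1 g.1.2 a = a by apply: clamp_id; lra.
  have -> : clamp g.1.1 g.1.2 b = b by apply: clamp_id; lra.
  by rewrite ifT//; lra.
- by rewrite subrr scale0r ifF ?scaler0//; apply/negbTE; lra.
- by rewrite subrr scale0r ifF ?scaler0//; apply/negbTE; lra.
Qed.

(** Free of endpoints, the step function has on (a, b) a constant value v, with
    cell integral (b - a) v; and the gauge of v at time q is at most its gauge
    at each r in (a, b). *)
Lemma cell_integral_Ynorm l p q : {in l, forall g, step_data x g} ->
  0 <= p -> p < q -> q <= 1 ->
  Yspace x q (cell_integral l p q) /\
  ((Ynorm x q (cell_integral l p q))%:E <= Znorm_on x p q (step_sum l))%E.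
Proof.
move=> lP p0 pq q1; have Zf := Zpre_step_sum lP.
apply: (@interval_induction R (fun a b => Yspace x q (cell_integral l a b) /\
  ((Ynorm x q (cell_integral l a b))%:E <= Znorm_on x a b (step_sum l))%E)
  (endpoints l) 1 p q) => //.
- move=> a b c pa ab bc cq [Yab Nab] [Ybc Nbc]; rewrite -(cell_integral_cat l a b c).
  split; first exact: lspanD.
  have a0 : 0 <= a := le_trans p0 pa; have c1 : c <= 1 := le_trans cq q1.
  apply: le_trans (Znorm_on_cat x_neq0 x_le1 Zf a0 ab bc c1).
  by apply: le_trans (leeD Nab Nbc); rewrite -EFinD lee_fin YnormD.
- move=> a b pa ab bq _ lS; have mab : a < (a + b) / 2 < b by lra.
  rewrite (cell_integral_constant lP mab lS).
  have Yf r : 0 < r -> r <= q -> Yspace x q (step_sum l r).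
    move=> r0 rq; apply: (Yspace_subset x_neq0 x_le1 rq).
    exact: (Zpre_Yspace x_neq0 x_le1).
  have Ym : Yspace x q (step_sum l ((a + b) / 2)) by apply: Yf; lra.
  split; first exact: lspanZ.
  apply: (@le_trans _ _ ((b - a) * Ynorm x q (step_sum l ((a + b) / 2)))%:E).
    rewrite lee_fin (le_trans (YnormZ_le _ Ym))// ger0_norm//; lra.
  apply: (Znorm_on_ge x_neq0 x_le1 Zf) => //; [lra|lra|exact: Ynorm_ge0|].
  move=> r ar; rewrite (step_sum_constant lS mab ar).
  apply: (Ynorm_nonincreasing x_neq0 x_le1); first lra.
  by apply: (Zpre_Yspace x_neq0 x_le1) => //; lra.
Qed.

End Completion.

(** * The approximating operators *)

Section Operators.
Context (R : realType) (X : completeNormedModType R) (x : nat -> X).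
Context (x_neq0 : forall n, x n != 0) (x_le1 : forall n, `|x n| <= 1).
Context (x_cvg0 : (fun n => `|x n|) @ \oo --> (0 : R)).
Context (Z : completeNormedModType R) (J : (R -> X) -> Z).
Context (hZ : is_Z_completion x J).
Implicit Types (f : R -> X) (y : X) (l : seq (R * R * X)).

Lemma cell_integral_linear a l l' (p q : R) :
  cell_integral (map (scale_data a) l ++ l') p q =
  a *: cell_integral l p q + cell_integral l' p q.
Proof.
rewrite /cell_integral big_cat big_map scaler_sumr; congr (_ + _).
by apply: eq_bigr => g _; rewrite scalerA mulrC -scalerA.
Qed.

(** By the compactness of Y_s in Y_p, y is a zonotope element, which has an image
    in a zonotope of Z, plus an element that is small in Y_p and hence gives a
    small step. *)
Lemma steps_compactly_approximable (s p q c : R) :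
  0 < s -> s < p -> p < q -> q < 1 -> 0 < c ->
  compactly_approximable [set J (step p q y) | y in dilate x s c].
Proof.
move=> s0 sp pq q1 c0 e e0.
(* A step of length q - p and gauge c h has norm at most e / 2. *)
pose h := e / 2 / c / (q - p).
have h0 : 0 < h by rewrite !divr_gt0// subr_gt0.
have [M UM] := Uset_zonotope_addition x_neq0 x_cvg0 sp h0.
pose w i := J (step p q (vertex x s i)).
have p0 : 0 < p by lra.
have Yw i : Yspace x p (vertex x s i).
  apply: (Yspace_subset x_neq0 x_le1 (ltW sp)).
  by apply: sub_lspan; exact: Uset_vertex.
exists (zonotope c w M); first by apply: compact_zonotope; exact: ltW.
move=> _ [y [_ /UM[_ [k k1 ->] [b Ub]]] y_eq <-].
have {y_eq} -> : y = c *: (\sum_(i < M) k i *: vertex x s i + b).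
  by rewrite y_eq scalerA mulfV ?scale1r// gt_eqF.
have hb : dilate x p h b by [].
have Yb : Yspace x p b by apply/YspaceP; exists h.
have Ysum : Yspace x p (\sum_(i < M) k i *: vertex x s i).
  rewrite /Yspace; elim/big_rec: _ => [|i z _ Yz]; first exact: lspan0.
  by apply: lspan_linear => //; exact: Yw.
exists (\sum_(i < M) (c * k i) *: w i).
  exists (fun i => c * k i) => // i; rewrite normrM gtr0_norm//.
  by rewrite ler_piMr// ltW.
have Zs y0 : Yspace x p y0 -> Zpre x (step p q y0) by exact: (Zpre_step x_neq0 x_le1 p0).
rewrite stepZ (JZ hZ); last by apply: Zs; exact: lspanD.
rewrite -[\sum_(i < M) k i *: _]scale1r step_linear scale1r.
rewrite (JD hZ); [|exact: Zs|exact: Zs].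
rewrite (J_step_sum x_neq0 x_le1 hZ _ _ p0)// scalerDr scaler_sumr.
under eq_bigr do rewrite scalerA.
rewrite addrAC subrr add0r normrZ gtr0_norm//.
rewrite (@le_lt_trans _ _ (c * ((q - p) * h)))//.
  rewrite ler_wpM2l ?(ltW c0)//.
  rewrite (le_trans (norm_J_step x_neq0 x_le1 hZ p0 (lexx p) (ltW pq) q1 Yb))//.
  by rewrite ler_wpM2l ?subr_ge0 ?(ltW pq)//; exact: Ynorm_le.
rewrite (_ : c * _ = e / 2); first by lra.
by rewrite /h; field; rewrite !gt_eqF ?subr_gt0.
Qed.

(** The average over (p, q) lies in Y_q. The condition q < p + d puts the
    interval on which it is used strictly after q, where the unit ball of Y_q is
    relatively compact. *)
Lemma cell_operator (p q d : R) : 0 <= p -> p < q -> q < p + d -> q + d < 1 ->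
  exists T : {linear Z -> Z}, [/\ forall z, `|T z| <= `|z|,
    compactly_approximable (T @` closed_ball 0 1),
    forall f, Zpre x f -> ((`|T (J f)|)%:E <= Znorm_on x p q f)%E &
    forall l, {in l, forall g, step_data x g} -> T (J (step_sum l)) =
      J (step (p + d) (q + d) ((q - p)^-1 *: cell_integral l p q))].
Proof.
move=> p0 pq qpd qd1; have q0 : 0 < q by lra.
have q1 : q <= 1 by lra.
have qp0 : 0 < q - p by rewrite subr_gt0.
pose A l := (q - p)^-1 *: cell_integral l p q.
have YA l : {in l, forall g, step_data x g} -> Yspace x q (A l).
  by move=> lP; apply: lspanZ; have [] := cell_integral_Ynorm x_neq0 x_le1 lP p0 pq q1.
have NA l : {in l, forall g, step_data x g} ->
    (((q - p) * Ynorm x q (A l))%:E <= Znorm_on x p q (step_sum l))%E.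
  move=> lP; have [Yl] := cell_integral_Ynorm x_neq0 x_le1 lP p0 pq q1.
  apply: le_trans; rewrite lee_fin -ler_pdivlMl// (le_trans (YnormZ_le _ Yl))//.
  by rewrite gtr0_norm ?invr_gt0.
have qpd' : q <= p + d := ltW qpd.
have pdqd : p + d <= q + d by rewrite lerD2r ltW.
have NJ l : {in l, forall g, step_data x g} ->
    ((`|J (step (p + d) (q + d) (A l))|)%:E <= Znorm_on x p q (step_sum l))%E.
  move=> lP; apply: le_trans (NA l lP); rewrite lee_fin.
  have := norm_J_step x_neq0 x_le1 hZ q0 qpd' pdqd qd1 (YA l lP).
  by rewrite opprD addrACA subrr addr0.
pose G z w := exists2 l, {in l, forall g, step_data x g} &
  z = J (step_sum l) /\ w = J (step (p + d) (q + d) (A l)).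
have Zstep l : {in l, forall g, step_data x g} ->
    Zpre x (step (p + d) (q + d) (A l)).
  by move=> lP; apply: (Zpre_step x_neq0 x_le1 q0) => //; exact: YA.
have [|||T [T1 TG]] := @contractive_relation_extension R Z Z G.
- move=> a _ _ _ _ [l lP [-> ->]] [l' l'P [-> ->]].
  exists (map (scale_data a) l ++ l').
    move=> g; rewrite mem_cat => /orP[/mapP[h hl ->]|]; last exact: l'P.
    exact/scale_step_data/lP.
  rewrite step_sum_linear (completion_linear hZ);
    [|exact: (Zpre_step_sum lP)|exact: (Zpre_step_sum l'P)].
  split => //; rewrite -(completion_linear hZ); [|exact: Zstep|exact: Zstep].
  rewrite -step_linear.
  congr (J (step _ _ _)); rewrite /A cell_integral_linear scalerDr.
  by rewrite !scalerA mulrC.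
- move=> _ _ [l lP [-> ->]]; rewrite -lee_fin (le_trans (NJ l lP))//.
  rewrite (completion_isometry hZ); last exact: Zpre_step_sum.
  by apply: (Znorm_on_le x_neq0 x_le1) => //; exact: Zpre_step_sum.
- move=> O O0 oO; have [z [Oz [f Zf fz]]] := completion_dense hZ O0 oO.
  exists z; split => //; have /ZpreP[l lP fl] := Zf.
  by exists (J (step (p + d) (q + d) (A l))), l; rewrite // -fl fz.
have TJ l : {in l, forall g, step_data x g} ->
    T (J (step_sum l)) = J (step (p + d) (q + d) (A l)).
  by move=> lP; apply: TG; exists l.
exists T; split => //.
  have c0 : 0 < 2 / (q - p) by rewrite divr_gt0.
  have qpd'' : p + d < q + d by rewrite ltrD2r.
  apply: compactly_approximableS (steps_compactly_approximable q0 qpd qpd'' qd1 c0).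
  move=> _ [z z1 <-]; apply/closure_normP => e e0.
  have z_le1 : `|z| <= 1.
    by move: z1; rewrite closed_ballE// /closed_ball_/= sub0r normrN.
  have m0 : 0 < Num.min e 2^-1 by rewrite lt_min e0/= invr_gt0 ltr0n.
  have [f Zf] := dense_J hZ z m0; rewrite lt_min => /andP[zfe zf1].
  have /ZpreP[l lP fl] := Zf.
  exists (T (J f)); last by rewrite -linearB (le_lt_trans (T1 _)).
  exists (A l); last by rewrite fl TJ.
  apply: Ynorm_lt; first exact: YA.
  rewrite ltr_pdivlMr// mulrC -lte_fin (le_lt_trans (NA l lP))//.
  rewrite -fl (le_lt_trans (Znorm_on_le x_neq0 x_le1 Zf p0 pq q1))//.
  rewrite -(completion_isometry hZ Zf) lte_fin.
  have := ler_normD (J f - z) z; rewrite subrK (distrC _ z).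
  by lra.
by move=> f /ZpreP[l lP ->]; rewrite TJ//; exact: NJ.
Qed.

(** The bound on t keeps the delayed step inside (0, 1). *)
Definition delays_steps (S : seq R) (d : R) (T : Z -> Z) : Prop :=
  forall s t y, s \in S -> t \in S -> 0 < s -> s < t -> t <= 1 - 2 * d ->
    Yspace x s y -> T (J (step s t y)) = J (step (s + d) (t + d) y).

(** The sum of the cell operators over a partition that contains S. Each bound is
    by the part of the norm due to its cell, so the sum is a contraction as
    well; the constant C, which grows with the number of cells, only serves to
    pass from step functions to Z. *)
Lemma delay_operator (S : seq R) (d : R) : 0 < d -> 2 * d < 1 ->
  exists T : {linear Z -> Z}, [/\ forall z, `|T z| <= `|z|,
    compactly_approximable (T @` closed_ball 0 1) & delays_steps S d T].
Proof.
move=> d0 d1.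
pose exact_on (p q : R) (T : Z -> Z) := forall s t y, s \in S -> t \in S ->
  0 < s -> s < t -> t <= 1 - 2 * d -> Yspace x s y ->
  T (J (step s t y)) = J (step (clamp s t p + d) (clamp s t q + d) y).
have [|||T [C [TC cT NT ST]]] := @interval_induction R (fun p q =>
  exists (T : {linear Z -> Z}) (C : R), [/\ forall z, `|T z| <= C * `|z|,
    compactly_approximable (T @` closed_ball 0 1),
    forall f, Zpre x f -> ((`|T (J f)|)%:E <= Znorm_on x p q f)%E &
    exact_on p q T]) S d 0 (1 - 2 * d) d0; [lra| | |].
- move=> a b c a0 ab bc c1 [T [C [TC cT NT ST]]] [T' [C' [TC' cT' NT' ST']]].
  exists (T \+ T' : {linear Z -> Z}), (C + C'); split.
  + by move=> z; rewrite (le_trans (ler_normD _ _))// mulrDl lerD.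
  + apply: compactly_approximableS (compactly_approximable_addition cT cT').
    move=> _ [z z1 <-]; apply: subset_closure.
    by exists (T z); [exists z|exists (T' z) => //; exists z].
  + move=> f Zf /=; have c_le1 : c <= 1 by lra.
    apply: le_trans (Znorm_on_cat x_neq0 x_le1 Zf a0 ab bc c_le1).
    apply: le_trans (leeD (NT f Zf) (NT' f Zf)).
    by rewrite -EFinD lee_fin ler_normD.
  + move=> s t y sS tS s0 st td Yy /=; rewrite ST// ST'//.
    have /andP[sa _] := clamp_itv a st; have /andP[_ ct] := clamp_itv c st.
    apply: (J_step_cat x_neq0 x_le1 hZ s0) => //.
    * lra.
    * by rewrite lerD2r clamp_monotone// ltW.
    * by rewrite lerD2r clamp_monotone// ltW.
    * lra.
- move=> a b a0 ab b1 abd abS.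
  have bad : b < a + d by lra.
  have bd1 : b + d < 1 by lra.
  have [T [T1 cT NT TE]] := cell_operator a0 ab bad bd1.
  exists T, 1; split => //; first by move=> z; rewrite mul1r.
  move=> s t y sS tS s0 st td Yy.
  have -> : step s t y = step_sum [:: (s, t, y)] by rewrite /step_sum big_seq1.
  rewrite TE; last by move=> g; rewrite inE => /eqP ->; split => //=; lra.
  rewrite /cell_integral big_seq1/=.
  (* The averaging is exact because the cell lies inside or outside (s, t). *)
  have [[sa bt]|[-> [-> bs]]|[-> [-> ta]]] := clamp_cell st ab (abS s sS) (abS t tS).
  + have -> : clamp s t a = a by apply: clamp_id; lra.
    have -> : clamp s t b = b by apply: clamp_id; lra.
    by rewrite scalerA mulVf ?scale1r// subr_eq0 gt_eqF.
  + by rewrite subrr scale0r scaler0 -(scale0r y) stepZ scale0r step_ge.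
  + by rewrite subrr scale0r scaler0 -(scale0r y) stepZ scale0r step_ge.
exists T; split => //.
- have TJ f : Zpre x f -> `|T (J f)| <= `|J f|.
    move=> Zf; rewrite -lee_fin (completion_isometry hZ Zf) (le_trans (NT f Zf))//.
    by apply: Znorm_on_le => //; lra.
  move=> z; apply/ler_addgt0Pl => e e0.
  have h0 : 0 < e / (`|C| + 1) by rewrite divr_gt0// ltr_wpDl.
  have [f Zf] := dense_J hZ z h0; rewrite ltr_pdivlMr ?ltr_wpDl// => zf.
  have := ler_normD (T (z - J f)) (T (J f)); rewrite -linearD subrK.
  have := TC (z - J f); have := TJ f Zf; have := ler_norm C.
  have := ler_normD (J f - z) z; rewrite subrK (distrC _ z).
  have := normr_ge0 (z - J f).
  nra.
- move=> s t y sS tS s0 st td Yy; rewrite ST// clamp_le ?clamp_ge//; lra.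
Qed.

End Operators.

(** * Convergence to the identity *)

Section Convergence.
Context (R : realType) (X : completeNormedModType R) (x : nat -> X).
Context (x_neq0 : forall n, x n != 0) (x_le1 : forall n, `|x n| <= 1).
Context (Z : completeNormedModType R) (J : (R -> X) -> Z).
Context (hZ : is_Z_completion x J).

(** The delayed step differs from the original one only on (s, s + d) and
    (t, t + d). *)
Lemma norm_delay_sub (s t d : R) y : 0 < s -> s < t -> 0 < d -> t + d < 1 ->
  Yspace x s y ->
  `|J (step (s + d) (t + d) y) - J (step s t y)| <= 2 * d * Ynorm x s y.
Proof.
move=> s0 st d0 td Yy.
have := J_step_cat x_neq0 x_le1 hZ s0 (lexx s) (ltW st) _ td Yy.
have := J_step_cat x_neq0 x_le1 hZ s0 (lexx s) _ _ td Yy.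
move=> /(_ (s + d)); rewrite !lerDl lerD2r !(ltW d0) (ltW st) => /(_ isT isT) <-.
move=> /(_ isT) E.
have -> : J (step (s + d) (t + d) y) - J (step s t y) =
    J (step t (t + d) y) - J (step s (s + d) y).
  rewrite (_ : J (step (s + d) _ _) =
    J (step s t y) + J (step t (t + d) y) - J (step s (s + d) y)).
    by rewrite [J _ + J _]addrC addrAC addrK.
  by rewrite E addrAC subrr add0r.
have n1 : `|J (step t (t + d) y)| <= (t + d - t) * Ynorm x s y.
  by apply: (norm_J_step x_neq0 x_le1 hZ s0) => //; lra.
have n2 : `|J (step s (s + d) y)| <= (s + d - s) * Ynorm x s y.
  by apply: (norm_J_step x_neq0 x_le1 hZ s0) => //; lra.
have := ler_normB (J (step t (t + d) y)) (J (step s (s + d) y)).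
by lra.
Qed.

Lemma delay_cvg f (e : R) : Zpre x f -> 0 < e ->
  exists (S0 : seq R) (d0 : R), 0 < d0 /\
  forall S d (T : {linear Z -> Z}), {subset S0 <= S} -> 0 < d -> d <= d0 ->
    delays_steps x J S d T -> `|T (J f) - J f| < e.
Proof.
move=> Zf; suff [_] : Zpre x f /\ forall e : R, 0 < e ->
  exists (S0 : seq R) (d0 : R), 0 < d0 /\
  forall S d (T : {linear Z -> Z}), {subset S0 <= S} -> 0 < d -> d <= d0 ->
    delays_steps x J S d T -> `|T (J f) - J f| < e by exact.
move: f {e} Zf; apply: (@lspan_ind _ _ _ [set f | Zpre x f /\ forall e : R, 0 < e ->
  exists (S0 : seq R) (d0 : R), 0 < d0 /\
  forall S d (T : {linear Z -> Z}), {subset S0 <= S} -> 0 < d -> d <= d0 ->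
    delays_steps x J S d T -> `|T (J f) - J f| < e]).
- split; first exact: lspan0.
  move=> e e0; exists [::], 1; split => // S d T _ _ _ _.
  by rewrite (J0 hZ) linear0 subrr normr0.
- move=> a f g [Zf cf] [Zg cg]; split; first exact: lspan_linear.
  move=> e e0; have e20 : 0 < e / 2 by rewrite divr_gt0.
  have a0 : 0 < `|a| + 1 by rewrite ltr_wpDl.
  have ea0 : 0 < e / 2 / (`|a| + 1) by rewrite !divr_gt0.
  have [S1 [d1 [d10 c1]]] := cf _ ea0; have [S2 [d2 [d20 c2]]] := cg _ e20.
  exists (S1 ++ S2), (Num.min d1 d2); rewrite lt_min d10; split => // S d T SS d0.
  rewrite le_min => /andP[dd1 dd2] TS.
  have n1 := c1 S d T (fun s s1 => SS s ltac:(by rewrite mem_cat s1)) d0 dd1 TS.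
  have n2 := c2 S d T (fun s s2 => SS s ltac:(by rewrite mem_cat s2 orbT)) d0 dd2 TS.
  rewrite (completion_linear hZ)// linearP opprD addrACA -scalerBr.
  rewrite (le_lt_trans (ler_normD _ _))// normrZ (splitr e) ltrD//.
  rewrite (@le_lt_trans _ _ ((`|a| + 1) * `|T (J f) - J f|)) ?ler_wpM2r ?lerDl//.
  by rewrite mulrC -ltr_pdivlMr.
- move=> _ [s [t [y [s0 st t1 Yy ->]]]].
  split; first by apply: (Zpre_step x_neq0 x_le1 s0) => //.
  move=> e e0; pose N := Ynorm x s y.
  have N0 : 0 <= N by exact: Ynorm_ge0.
  exists [:: s; t], (Num.min ((1 - t) / 2) (e / 4 / (N + 1))).
  split; first by rewrite lt_min !divr_gt0 ?subr_gt0 ?ltr_wpDl.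
  move=> S d T SS d0; rewrite le_min => /andP[dt dN] TS.
  rewrite TS//; [|by apply: SS; rewrite !inE eqxx ?orbT..|lra].
  have td : t + d < 1 by lra.
  rewrite (le_lt_trans (norm_delay_sub s0 st d0 td Yy))// -/N.
  move: dN; rewrite ler_pdivlMr ?ltr_wpDl// => dN.
  nra.
Qed.

End Convergence.

Theorem proposition2 (R : realType) (X : completeNormedModType R)
    (hX : ~ approximation_property X)
    (x : nat -> X)
    (x_neq0 : forall n, x n != 0)
    (x_le1 : forall n, `|x n| <= 1)
    (x_noninc : nonincreasing_seq (fun n => `|x n|))
    (x_cvg0 : (fun n => `|x n|) @ \oo --> (0 : R))
    (hK : exists2 e : R, 0 < e &
      ~ finite_rank_approximable_on (closed_conv_hull (range x)) e)
    (Z : completeNormedModType R) (J : (R -> X) -> Z)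
    (hZ : is_Z_completion x J) :
  compact_approximation_property Z.
Proof.
move=> K cK e e0.
(* The operators are directed by the set of prescribed endpoints and the delay;
   compactness of K makes the pointwise convergence along F uniform. *)
pose base (i : seq R * R) :=
  [set j : seq R * R | {subset i.1 <= j.1} /\ 0 < j.2 <= i.2].
pose F := filter_from [set i : seq R * R | 0 < i.2] base.
have FF : Filter F.
  apply: filter_from_filter; first by exists ([::], 1) => /=.
  move=> [S d] [S' d'] /= d0 d'0; exists (S ++ S', Num.min d d').
    by rewrite /= lt_min d0.
  move=> [S'' d''] [/= SS]; rewrite le_min => /and3P[d''0 ? ?].
  by split; split; rewrite ?d''0//= => s sS; apply: SS; rewrite mem_cat sS ?orbT.
have e50 : 0 < e / 5 by rewrite divr_gt0.
have cov z : K z -> \forall z' \near z & i \near F,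
    forall T : {linear Z -> Z}, (forall z, `|T z| <= `|z|) ->
      delays_steps x J i.1 i.2 T -> `|T z' - z'| < e.
  move=> _; have [f Zf zf] := dense_J hZ z e50.
  have [S0 [d0 [d00 Tf]]] := delay_cvg x_neq0 x_le1 hZ Zf e50.
  exists (ball z (e / 5), base (S0, d0)).
    by split; [exact: nbhsx_ballx|exists (S0, d0)].
  move=> [z' [S d]] [/=]; rewrite -ball_normE/= => zz' [/= SS /andP[d_gt0 dd0]].
  move=> T T1 TS.
  have := Tf S d T SS d_gt0 dd0 TS.
  have -> : T z' - z' = T (z' - J f) + (T (J f) - J f) + (J f - z').
    by rewrite linearB (addrA (T z' - _)) subrK addrA subrK.
  have := ler_normD (T (z' - J f) + (T (J f) - J f)) (J f - z').
  have := ler_normD (T (z' - J f)) (T (J f) - J f).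
  have := T1 (z' - J f); have := ler_distD z z' (J f).
  by rewrite (distrC z' z) (distrC (J f)); lra.
move/compact_near_coveringP : cK => /(_ _ F _ FF cov) [[S d] /= d0 KSd].
pose d' := Num.min d 4^-1.
have d'0 : 0 < d' by rewrite lt_min d0/= invr_gt0 ltr0n.
have d'd : d' <= d by rewrite ge_min lexx.
have d'4 : d' <= 4^-1 by rewrite ge_min lexx orbT.
have d'1 : 2 * d' < 1 by lra.
have [T [T1 cT TS]] := delay_operator x_neq0 x_le1 x_cvg0 hZ S d'0 d'1.
exists T; split; first exact: compactly_approximable_precompact.
by move=> z Kz; apply: (KSd (S, d')) => //; split => //=; rewrite d'0.
Qed.
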